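(* Let $G$ be a connected bridgeless cubic graph such that the Petersen graph $P$ admits a $G$-coloring. Then $G$ is isomorphic to $P$.
   Context: Graphs are finite, undirected, without loops, possibly with multiple edges. For a vertex $v$ of a graph $G$, $\partial_G(v)$ denotes the set of edges incident to $v$. For cubic graphs $G$ and $H$, an $H$-coloring of $G$ is a map $f\colon E(G)\to E(H)$ which is a proper edge-coloring (adjacent edges of $G$ receive distinct edges of $H$) such that for every vertex $x$ of $G$ there is a vertex $y$ of $H$ with $f(\partial_G(x))=\partial_H(y)$; the paper writes $H\prec G$ when $G$ admits an $H$-coloring, so the hypothesis is $G\prec P$. The Petersen graph $P$ is the cubic graph on 10 vertices $u_1,\dots,u_5,v_1,\dots,v_5$ with edges $u_iu_{i+1}$, $u_iv_i$, $v_iv_{i+2}$ (indices mod 5). *)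

(* Defs.v *)
From mathcomp Require Import all_boot all_order all_algebra.

Set Implicit Arguments.
Unset Strict Implicit.
Unset Printing Implicit Defensive.

(* Finite undirected loopless multigraphs: parallel edges are distinct
   elements of [edge G] with the same two-element set of ends. *)
Record mgraph := MGraph {
  vert : finType;
  edge : finType;
  ends : edge -> {set vert};
  ends_card2 : forall e : edge, #|ends e| = 2
}.

Definition incident (G : mgraph) (v : vert G) : {set edge G} :=
  [set e | v \in ends e].

Definition cubic (G : mgraph) : Prop :=
  forall v : vert G, #|incident v| = 3.

(* Adjacency in the spanning subgraph of G with edge set F. *)
Definition adj_in (G : mgraph) (F : {set edge G}) : rel (vert G) :=
  fun x y => [exists e in F, ends e == [set x; y]].

Definition components (G : mgraph) (F : {set edge G}) : nat :=
  n_comp (adj_in F) [set: vert G].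

Definition connected (G : mgraph) : Prop :=
  components [set: edge G] = 1.

Definition bridge (G : mgraph) (e : edge G) : Prop :=
  components [set: edge G] < components [set~ e].

Definition bridgeless (G : mgraph) : Prop :=
  forall e : edge G, ~ bridge e.

Definition adjacent_edges (G : mgraph) (e e' : edge G) : Prop :=
  e <> e' /\ exists v : vert G, v \in ends e /\ v \in ends e'.

Definition proper_edge_coloring (G : mgraph) (C : Type) (f : edge G -> C) : Prop :=
  forall e e' : edge G, adjacent_edges e e' -> f e <> f e'.

Definition is_coloring_by (H G : mgraph) (f : edge G -> edge H) : Prop :=
  proper_edge_coloring f /\
  forall x : vert G, exists y : vert H, f @: incident x = incident y.

(* [admits_coloring H G] is H \prec G: G admits an H-coloring. *)
Definition admits_coloring (H G : mgraph) : Prop :=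
  exists f : edge G -> edge H, is_coloring_by f.

Definition isomorphic (G H : mgraph) : Prop :=
  exists (fV : vert G -> vert H) (fE : edge G -> edge H),
    [/\ bijective fV, bijective fE &
        forall e : edge G, ends (fE e) = fV @: ends e].

(* Vertices: [inl i] is u_i and [inr i] is v_i. Edges: [inl (inl i)] is
   u_i u_(i+1), [inl (inr i)] is u_i v_i and [inr i] is v_i v_(i+2). The
   addition is that of the ring 'I_5, hence modulo 5. *)
Definition petersen_ends (e : 'I_5 + 'I_5 + 'I_5) : {set 'I_5 + 'I_5} :=
  match e with
  | inl (inl i) => [set inl i; inl (i + 1)%R]
  | inl (inr i) => [set inl i; inr i]
  | inr i => [set inr i; inr (i + 2%:R)%R]
  end.

Lemma petersen_ends_card2 e : #|petersen_ends e| = 2.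
Proof.
by case: e => [[]|] [[|[|[|[|[|//]]]]] ?]; rewrite cards2.
Qed.

Definition petersen : mgraph := MGraph petersen_ends_card2.

(* Main.v *)
Require Import Defs.
From mathcomp Require Import all_boot all_order all_algebra.

(** Let [f] be a [G]-coloring of the Petersen graph [P] and choose, for each
    vertex [x] of [P], a vertex [g x] of [G] whose star is the image of the
    star of [x]. As an edge of [G] has two ends, it lies in at most two
    distinct images of stars. A backtracking search over the partitions of the
    15 edges of [P] into fibres of [f] shows that this condition leaves only
    two possibilities: [f] is injective, or exactly one edge of [G] leaves the
    set [g(V(P))]. The latter edge is a bridge, which is excluded. If [f] is
    injective, so is [g]; its image is closed under adjacency, hence is all of
    [G] by connectedness, and [(g, f)] is an isomorphism. *)

(** * Sequences up to renaming of their values *)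

Section EqualityPatterns.

Variable T : eqType.
Implicit Types (A B : seq T) (y : T).

(* A sequence up to renaming of its values: each item is replaced by the
   position of its first occurrence. *)
Definition pattern A : seq nat := [seq index y A | y <- A].

Lemma pattern_rcons A y :
  pattern (rcons A y) = rcons (pattern A) (index y (rcons A y)).
Proof.
rewrite /pattern map_rcons; congr rcons; apply/eq_in_map => z zA.
by rewrite -cats1 index_cat zA.
Qed.

(** A fresh item gets the code [size A], a repeated one the code it already has: these are the
    branches of the search. *)
Lemma index_rcons_pattern A y :
  index y (rcons A y) \in size (pattern A) :: undup (pattern A).
Proof.
rewrite size_map inE mem_undup -cats1 index_cat; case: ifP => yA.
  by apply/orP; right; apply: map_f.
by rewrite /= eqxx addn0 eqxx.
Qed.

Lemma index_in_inj A : {in A &, injective (index^~ A)}.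
Proof. by move=> y z; apply: (@index_inj _ y). Qed.

Lemma pattern_uniq A : uniq (pattern A) = uniq A.
Proof. exact/map_inj_in_uniq/index_in_inj. Qed.

Lemma mem_map_index A B y :
    {subset B <= A} -> y \in A ->
  (index y A \in [seq index z A | z <- B]) = (y \in B).
Proof.
move=> sBA yA; apply/mapP/idP => [[z zB] | yB]; last by exists y.
by move/index_in_inj=> -> //; apply: sBA.
Qed.

Lemma prefix_mask_take (m : bitseq) k A :
  prefix (mask m (take k A)) (mask m A).
Proof.
elim: A m k => [|y A IHA] [|b m] [|k] //=; rewrite ?mask0 ?prefix0s //.
by case: b => /=; rewrite ?eqxx IHA.
Qed.

End EqualityPatterns.

Arguments pattern {T} A.

(** [F1] and [F2] identify the same items of [s], so their distinct values correspond. This carries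
    counts from codes to vertices and edges of [G]. *)
Lemma count_undup_map (X : Type) (T1 T2 : eqType) (F1 : X -> T1) (F2 : X -> T2)
    (p1 : pred T1) (p2 : pred T2) (s : seq X) (Q : pred X) :
    all Q s ->
    (forall x, Q x -> p1 (F1 x) = p2 (F2 x)) ->
    (forall x y, Q x -> Q y -> (F1 x == F1 y) = (F2 x == F2 y)) ->
  count p1 (undup (map F1 s)) = count p2 (undup (map F2 s)).
Proof.
move=> Qs p12 F12; elim: s Qs => //= x s IHs /andP[Qx Qs].
have -> : (F1 x \in map F1 s) = (F2 x \in map F2 s).
  elim: s Qs {IHs} => //= y s IHs /andP[Qy Qs].
  by rewrite !inE F12 // IHs.
by case: ifP => _ /=; rewrite IHs // p12.
Qed.

Lemma uniq_map_inj_in (T1 T2 : eqType) (F : T1 -> T2) (s : seq T1) :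
  uniq (map F s) -> {in s &, injective F}.
Proof.
elim: s => //= a s IHs /andP[Fa_notin uniq_s] x y; rewrite !inE.
move=> /predU1P[->|xs] /predU1P[->|ys] // eqF.
- by rewrite eqF map_f in Fa_notin.
- by rewrite -eqF map_f in Fa_notin.
exact: IHs.
Qed.

(** * The backtracking search and its soundness *)

Section Search.

(* A graph with its edges listed in a fixed order, each vertex being given by
   the mask of its incident edges. In a partial coloring [s] of the first
   [size s] edges, [mask m s] has size 3 iff the star [m] is fully colored. *)
Variable stars : seq bitseq.

(** Sorting lets a sequence stand for a set, so that stars with the same image count once, as one
    vertex of [G]. *)
Definition triples (s : seq nat) : seq (seq nat) :=
  undup [seq sort leq (mask m s) | m <- stars & size (mask m s) == 3].

Definition degree (s : seq nat) (l : nat) : nat :=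
  count (fun t => l \in t) (triples s).

Definition valid (s : seq nat) : bool :=
  all (fun m => uniq (mask m s)) stars && all (fun l => degree s l <= 2) s.

(* The second alternative says that exactly one color has a single end among
   the images of the stars. *)
Definition rigid (s : seq nat) : bool :=
  uniq s || (count (fun l => degree s l == 1) (undup s) == 1).

Fixpoint search (n : nat) (s : seq nat) : bool :=
  if ~~ valid s then true else
  if n is n'.+1 then
    all (fun l => search n' (rcons s l)) (size s :: undup s)
  else rigid s.

(** Valid prefixes are never pruned, and each next code is among the branches, so the search reaches
    [pattern (A ++ B)] as a leaf. *)
Lemma search_sound (T : eqType) (A B : seq T) :
    (forall k, valid (pattern (take k (A ++ B)))) ->
  search (size B) (pattern A) -> rigid (pattern (A ++ B)).
Proof.
elim: B A => [|y B IHB] A valAB /=.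
  by have := valAB (size A); rewrite take_size_cat // cats0 => ->.
have := valAB (size A); rewrite take_size_cat // => -> /=.
case/andP=> search_new /allP search_old.
rewrite -cat_rcons; apply: IHB; first by rewrite cat_rcons.
rewrite pattern_rcons.
have := index_rcons_pattern _ A y; rewrite inE => /orP[/eqP-> // | ].
exact: search_old.
Qed.

End Search.

(** * Components, bridges, and colorings that yield isomorphisms *)

Lemma count_ends_undup (G : mgraph) (s : seq (vert G)) (y : edge G) :
  count (fun v => v \in ends y) (undup s) = #|ends y :&: [set v in s]|.
Proof.
rewrite -size_filter -(card_uniqP (filter_uniq _ (undup_uniq s))).
by apply: eq_card => v; rewrite !inE mem_filter mem_undup.
Qed.

Lemma adj_in_sym (G : mgraph) (F : {set edge G}) : symmetric (adj_in F).
Proof. by move=> x y; apply: eq_existsb => e; rewrite setUC. Qed.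

Lemma connect_adj_in_sym (G : mgraph) (F : {set edge G}) :
  connect_sym (adj_in F).
Proof. exact/sym_connect_sym/adj_in_sym. Qed.

Lemma connected_connect (G : mgraph) (x y : vert G) :
  connected G -> connect (adj_in [set: edge G]) x y.
Proof.
rewrite /connected /components => conn.
have symG := connect_adj_in_sym G [set: edge G].
rewrite -(root_connect symG); apply/eqP.
have /card_le1_eqP : n_comp (adj_in [set: edge G]) [set: vert G] <= 1.
  by rewrite conn.
by apply; rewrite !inE roots_root.
Qed.

Lemma cut_edge_bridge (G : mgraph) (S : {set vert G}) (h : edge G) :
    connected G -> #|ends h :&: S| = 1 ->
    (forall e, e != h -> #|ends e :&: S| != 1) ->
  bridge h.
Proof.
move=> conn hS eS; rewrite /bridge conn.
have symG := connect_adj_in_sym G [set~ h].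
(* Every edge other than [h] has none or both of its ends in [S]. *)
have closedS : closed (adj_in [set~ h]) (mem S).
  move=> x y /existsP[e /andP[]]; rewrite !inE => /eS eS1 /eqP ends_e.
  move: eS1; rewrite ends_e setIUl; apply: contraNeq.
  have set1IS z : [set z] :&: S = if z \in S then [set z] else set0.
    by case: ifP => zS; apply/setP => t; rewrite !inE; case: eqP => // ->.
  by rewrite !set1IS; do 2?case: ifP => _; rewrite ?setU0 ?set0U ?cards1.
have [a ha] : exists a, a \in ends h :&: S.
  by apply/set0Pn; rewrite -card_gt0 hS.
have [b hb] : exists b, b \in ends h :\: S.
  apply/set0Pn; rewrite -card_gt0.
  by have := cardsID S (ends h); rewrite ends_card2 hS add1n => -[->].
move: ha hb; rewrite !inE => /andP[_ aS] /andP[bS _].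
apply/card_gt1P.
exists (fingraph.root (adj_in [set~ h]) a), (fingraph.root (adj_in [set~ h]) b).
rewrite !inE !roots_root //; split=> //.
rewrite root_connect //; apply: contra bS => ab.
by rewrite -(closed_connect closedS ab).
Qed.

(* When two vertices of [G] have the same star (three parallel edges), the
   choice of [g x] must depend on that star only. *)
Lemma coloring_vertex_map (H G : mgraph) (f : edge H -> edge G) :
    is_coloring_by f ->
  exists2 g : vert H -> vert G,
    forall x, f @: incident x = incident (g x) &
    forall x x', incident (g x) = incident (g x') -> g x = g x'.
Proof.
case=> _ fP; have exg x : exists y, f @: incident x == incident y.
  by have [y ->] := fP x; exists y.
exists (fun x => xchoose (exg x)) => [x | x x' eq_inc].
  exact/eqP/(xchooseP (exg x)).
apply: eq_xchoose => y.
by rewrite (eqP (xchooseP (exg x))) eq_inc -(eqP (xchooseP (exg x'))).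
Qed.

Lemma injective_coloring_isomorphic (H G : mgraph) (f : edge H -> edge G)
    (x0 : vert H) :
    connected G -> injective (@incident H) -> is_coloring_by f ->
  injective f -> isomorphic G H.
Proof.
move=> conn inc_inj colf f_inj; have [g gP _] := coloring_vertex_map _ _ _ colf.
have g_inj : injective g.
  by move=> x x' eqg; apply/inc_inj/(imset_inj f_inj); rewrite !gP eqg.
(* [g] maps the ends of [e] into those of [f e], and both sets have two elements. *)
have endsf e : ends (f e) = g @: ends e.
  apply/esym/eqP; rewrite eqEcard card_imset // !ends_card2 leqnn andbT.
  apply/subsetP=> _ /imsetP[x xe ->].
  have : f e \in incident (g x) by rewrite -gP imset_f // inE.
  by rewrite inE.
(* An edge at [g x] has the form [f e], so its other end is in the image of [g] too. *)
have closedg : closed (adj_in [set: edge G]) (mem (codom g)).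
  apply: intro_closed; first exact: connect_adj_in_sym.
  move=> y z /existsP[h /andP[_ /eqP ends_h]] /codomP[x def_y].
  have : h \in f @: incident x by rewrite gP inE ends_h def_y set21.
  case/imsetP=> e _ def_h; have : z \in ends h by rewrite ends_h set22.
  by rewrite def_h endsf => /imsetP[x' _ ->]; apply: codom_f.
have g_surj y : y \in codom g.
  have x0y := connected_connect _ (g x0) y conn.
  by rewrite -(closed_connect closedg x0y) codom_f.
have f_surj h : h \in codom f.
  have [y yh] : exists y, y \in ends h.
    by apply/set0Pn; rewrite -card_gt0 ends_card2.
  have /codomP[x def_y] := g_surj y.
  have : h \in f @: incident x by rewrite gP inE -def_y.
  by case/imsetP=> e _ ->; apply: codom_f.
exists (fun y => iinv (g_surj y)), (fun h => iinv (f_surj h)).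
have giK : cancel (fun y => iinv (g_surj y)) g by move=> y; apply: f_iinv.
have fiK : cancel (fun h => iinv (f_surj h)) f by move=> h; apply: f_iinv.
split; first by exists g => // x; apply: g_inj.
  by exists f => // e; apply: f_inj.
move=> h; apply/(imset_inj g_inj); rewrite -endsf fiK -imset_comp.
by rewrite (eq_imset _ giK) imset_id.
Qed.

(** * The Petersen graph in computable form *)

Definition ords5 : seq 'I_5 :=
  [:: @Ordinal 5 0 isT; @Ordinal 5 1 isT; @Ordinal 5 2 isT;
      @Ordinal 5 3 isT; @Ordinal 5 4 isT].

(* The order along the inner cycle: stars are completed early, which prunes the
   search. *)
Definition pentagram5 : seq 'I_5 :=
  [:: @Ordinal 5 0 isT; @Ordinal 5 2 isT; @Ordinal 5 4 isT;
      @Ordinal 5 1 isT; @Ordinal 5 3 isT].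

Definition petersen_verts : seq (vert petersen) :=
  [seq inl i | i <- ords5] ++ [seq inr i | i <- ords5].

Definition petersen_edges : seq (edge petersen) :=
  [seq inl (inl i) | i <- ords5] ++ [seq inl (inr i) | i <- ords5]
  ++ [seq inr i | i <- pentagram5].

Definition petersen_inc (x : vert petersen) (e : edge petersen) : bool :=
  match e with
  | inl (inl i) => (x == inl i) || (x == inl (i + 1)%R)
  | inl (inr i) => (x == inl i) || (x == inr i)
  | inr i => (x == inr i) || (x == inr (i + 2%:R)%R)
  end.

Lemma mem_incident_petersen x e : (e \in incident x) = petersen_inc x e.
Proof. by rewrite inE; case: e => [[]|] i; rewrite !inE. Qed.

Lemma mem_petersen_verts x : x \in petersen_verts.
Proof. by case: x => [] [[|[|[|[|[|//]]]]] ?]. Qed.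

Lemma mem_petersen_edges e : e \in petersen_edges.
Proof. by case: e => [[]|] [[|[|[|[|[|//]]]]] ?]. Qed.

Definition petersen_star (x : vert petersen) : bitseq :=
  [seq petersen_inc x e | e <- petersen_edges].

(** Evaluated beforehand, so that the search runs on explicit masks. *)
Definition petersen_stars : seq bitseq :=
  Eval vm_compute in [seq petersen_star x | x <- petersen_verts].

Lemma petersen_starsE :
  petersen_stars = [seq petersen_star x | x <- petersen_verts].
Proof. by []. Qed.

Lemma petersen_search : search petersen_stars 15 [::].
Proof. vm_cast_no_check (erefl true). Qed.

Lemma size_incident_petersen x :
  size [seq e <- petersen_edges | petersen_inc x e] = 3.
Proof.
apply/eqP; move: x (mem_petersen_verts x); apply/allP.
by vm_compute.
Qed.

Lemma petersen_incident_inj : injective (@incident petersen).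
Proof.
have star_inj : uniq petersen_stars by vm_compute.
move=> x x' eq_inc; have eq_star : petersen_star x = petersen_star x'.
  by apply: eq_map => e; rewrite -!mem_incident_petersen eq_inc.
move: star_inj; rewrite petersen_starsE => /uniq_map_inj_in.
by apply=> //; apply: mem_petersen_verts.
Qed.

(** * Colorings of the Petersen graph as inputs of the search *)

Section PetersenColoring.

Variables (G : mgraph) (f : edge petersen -> edge G).
Variable g : vert petersen -> vert G.
Hypothesis cubG : cubic G.
Hypothesis gP : forall x, f @: incident x = incident (g x).
Hypothesis g_can : forall x x', incident (g x) = incident (g x') -> g x = g x'.

Let F := [seq f e | e <- petersen_edges].

Lemma mask_starE x :
  mask (petersen_star x) F
  = [seq f e | e <- petersen_edges & petersen_inc x e].
Proof. by rewrite -map_mask -filter_mask. Qed.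

Lemma mem_mask_star x y :
  (y \in mask (petersen_star x) F) = (g x \in ends y).
Proof.
have -> : (g x \in ends y) = (y \in incident (g x)) by rewrite inE.
rewrite mask_starE -gP; apply/mapP/imsetP => -[e].
  by rewrite mem_filter -mem_incident_petersen => /andP[xe _]; exists e.
move=> xe; exists e => //.
by rewrite mem_filter -mem_incident_petersen xe mem_petersen_edges.
Qed.

Lemma size_mask_star x : size (mask (petersen_star x) F) = 3.
Proof. by rewrite mask_starE size_map size_incident_petersen. Qed.

(** The three entries cover the star of [g x], which has three edges as [G] is cubic. *)
Lemma mask_star_uniq x : uniq (mask (petersen_star x) F).
Proof.
apply/card_uniqP; rewrite size_mask_star -(cubG (g x)).
by apply: eq_card => y; rewrite mem_mask_star inE.
Qed.

Let complete k x := size (mask (petersen_star x) (take k F)) == 3.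

Lemma complete_mask k x :
  complete k x -> mask (petersen_star x) (take k F) = mask (petersen_star x) F.
Proof.
move/eqP=> size3.
have /prefixP[B defF] := prefix_mask_take _ (petersen_star x) k F.
have := size_mask_star x; rewrite defF size_cat size3 => /eqP.
by rewrite -{2}[3]addn0 eqn_add2l size_eq0 => /eqP->; rewrite cats0.
Qed.

(** By [g_can], complete stars have equal triples exactly when their vertices have equal images
    under [g]; so the triples containing the code of [y] correspond to ends of [y]. *)
Lemma degree_pattern k y :
    y \in take k F ->
  degree petersen_stars (pattern (take k F)) (index y (take k F))
  = count (fun v => v \in ends y)
      (undup [seq g x | x <- petersen_verts & complete k x]).
Proof.
set A := take k F => yA; rewrite /degree /triples petersen_starsE.
have maskA x : mask (petersen_star x) (pattern A)
    = [seq index z A | z <- mask (petersen_star x) A] by rewrite -map_mask.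
have subA x : {subset mask (petersen_star x) A <= A} by move=> z /mem_mask.
rewrite filter_map -map_comp.
have -> : [seq x <- petersen_verts
    | preim petersen_star (fun m => size (mask m (pattern A)) == 3) x]
    = [seq x <- petersen_verts | complete k x].
  by apply: eq_filter => x /=; rewrite maskA size_map.
apply: (count_undup_map _ _ _ _ _ _ _ _ (complete k)).
- exact: filter_all.
- move=> x cx /=; rewrite mem_sort maskA mem_map_index //.
  by rewrite complete_mask // mem_mask_star.
move=> x x' cx cx' /=; rewrite !maskA.
have sortP := perm_sortP leq_total leq_trans anti_leq.
apply/eqP/eqP => [/sortP/perm_mem eqxx' | eqg].
  apply: g_can; apply/setP => z.
  rewrite !inE -!mem_mask_star -!(complete_mask k) //.
  have [zA | zA] := boolP (z \in A).
    by have := eqxx' (index z A); rewrite !mem_map_index.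
  by rewrite (contraNF (subA x z) zA) (contraNF (subA x' z) zA).
apply/sortP/perm_map.
rewrite !complete_mask //; apply: uniq_perm; rewrite ?mask_star_uniq // => z.
by rewrite !mem_mask_star eqg.
Qed.

Lemma pattern_valid k : valid petersen_stars (pattern (take k F)).
Proof.
set A := take k F; apply/andP; split.
  rewrite petersen_starsE all_map; apply/allP => x _ /=.
  rewrite -map_mask map_inj_in_uniq; last first.
    by move=> y z /mem_mask yA /mem_mask zA; apply: index_in_inj.
  have /prefixP[B defF] := prefix_mask_take _ (petersen_star x) k F.
  by have := mask_star_uniq x; rewrite defF cat_uniq => /andP[].
rewrite all_map; apply/allP => y yA /=.
rewrite degree_pattern // count_ends_undup.
by rewrite -(ends_card2 y) subset_leq_card // subsetIl.
Qed.

Lemma petersen_coloring_injective :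
  connected G -> bridgeless G -> injective f.
Proof.
move=> conn nobridge.
have := search_sound petersen_stars _ [::] F pattern_valid.
move/(_ petersen_search).
rewrite /rigid pattern_uniq => /orP[uniqF | ].
  move=> e e'; apply: (uniq_map_inj_in _ _ _ _ uniqF);
  exact: mem_petersen_edges.
set S := [set v in [seq g x | x <- petersen_verts]].
have degF y : y \in F ->
    degree petersen_stars (pattern F) (index y F) = #|ends y :&: S|.
  move=> yF; have := degree_pattern (size F) y; rewrite take_size => -> //.
  (* Once all edges are colored, every star is complete. *)
  by rewrite count_ends_undup (_ : filter _ _ = petersen_verts).
pose p y := #|ends y :&: S| == 1.
rewrite /pattern (count_undup_map _ _ _ _ id _ p _ (mem F)); first last.
- by move=> y z yF zF; rewrite (inj_in_eq (@index_in_inj _ F)).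
- by move=> y yF; rewrite degF.
- exact/allP.
rewrite map_id -size_filter => /eqP.
case def_h: (filter _ _) => [|h [|]] // _.
(* Such a [y] has some [g x] as an end, hence occurs in [F], where only [h] has a single end in
   [S]. *)
have one_end y : #|ends y :&: S| == 1 -> y = h.
  move=> yS; apply/eqP; rewrite -mem_seq1 -def_h mem_filter /p yS.
  have /set0Pn[v] : ends y :&: S != set0 by rewrite -card_gt0 (eqP yS).
  case/setIP=> vy; rewrite in_set => /mapP[x _ def_v].
  rewrite mem_undup (@mem_mask _ _ (petersen_star x)) //.
  by rewrite mem_mask_star -def_v.
have : h \in [:: h] by rewrite mem_head.
rewrite -def_h mem_filter => /andP[/eqP hS _].
case: (nobridge h); apply: (cut_edge_bridge _ S) => // e.
by apply: contraNN => /one_end->.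
Qed.

End PetersenColoring.

Theorem theorem1 (G : mgraph) (conn : connected G) (bl : bridgeless G)
  (cub : cubic G) (col : admits_coloring G petersen) : isomorphic G petersen.
Proof.
have [f colf] := col.
have [g gP g_can] := coloring_vertex_map _ _ _ colf.
apply: (injective_coloring_isomorphic _ _ f (inl ord0)) => //.
  exact: petersen_incident_inj.
exact: (petersen_coloring_injective _ _ _ cub gP g_can).
Qed.
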